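(* Let $(\mathbb{Z},w)$ be a physical linear graph supported on the infinite line $\mathbb{Z}$ which satisfies $\mathrm{CD}(0,\infty)$. Then there is a constant $c>0$ such that $w(n,n+1)=c$ for all $n\in\mathbb{Z}$.
   Context: A weighted graph $G=(V,E,w,m)$ is a connected, undirected, simple, locally finite graph $(V,E)$ with vertex weights $m:V\to(0,\infty)$ and symmetric edge weights $w:E\to(0,\infty)$, $w(x,y)=w(y,x)$ (with $w(x,y)=0$ if $x\not\sim y$). It is physical if $m\equiv 1$. It is a linear graph if $V=\mathbb{Z}\cap I$ for a (bounded or unbounded) interval $I\subset\mathbb{R}$ and $E=\{\{n,n+1\}: n,n+1\in V\}$. The Laplacian is $\Delta f(x)=\frac1{m(x)}\sum_{y\sim x}w(x,y)(f(y)-f(x))$ for $f:V\to\mathbb{R}$. Set $\Gamma(f,g)=\frac12(\Delta(fg)-f\Delta g-g\Delta f)$, $\Gamma(f)=\Gamma(f,f)$, and $\Gamma_2(f)=\frac12\Delta\Gamma(f)-\Gamma(f,\Delta f)$. For $K\in\mathbb{R}$, $D\in(0,\infty]$ (with $1/\infty=0$) and $x\in V$, the condition $\mathrm{CD}(K,D,x)$ means $\Gamma_2(f)(x)\ge\frac1D(\Delta f(x))^2+K\,\Gamma(f)(x)$ for all $f:V\to\mathbb{R}$; $\mathrm{CD}(K,D)$ means that $\mathrm{CD}(K,D,x)$ holds for all $x\in V$. *)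

(* Defs.v *)
From HB Require Import structures.
From mathcomp Require Import all_boot all_order all_algebra.
From mathcomp Require Import all_classical all_reals ereal.

Set Implicit Arguments.
Unset Strict Implicit.
Unset Printing Implicit Defensive.

Import Order.TTheory GRing.Theory Num.Theory.
Local Open Scope classical_set_scope.
Local Open Scope ring_scope.

(* The weight is a function on all pairs of vertices, extended by 0 off the
   edges. *)
Record weighted_graph (R : realType) (V : choiceType) := WeightedGraph {
  adj : rel V;
  weight : V -> V -> R;
  mass : V -> R;
  adj_sym : symmetric adj;
  adj_irrefl : irreflexive adj;
  adj_locally_finite : forall x, finite_set [set y | adj x y];
  adj_connected : forall x y, exists2 p : seq V, path adj x p & last x p = y;
  weight_sym : forall x y, weight x y = weight y x;
  weight_gt0 : forall x y, adj x y -> 0 < weight x y;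
  weight_eq0 : forall x y, ~~ adj x y -> weight x y = 0;
  mass_gt0 : forall x, 0 < mass x }.

Definition physical (R : realType) (V : choiceType) (G : weighted_graph R V) :=
  forall x, mass G x = 1.

(* Linear graphs with I the whole real line: V = Z and the edges are exactly
   the pairs {n, n + 1}. *)
Definition linear_on_Z (R : realType) (G : weighted_graph R int) :=
  forall x y : int, adj G x y <-> (y = x + 1 \/ x = y + 1).

Definition laplacian (R : realType) (V : choiceType) (G : weighted_graph R V)
    (f : V -> R) (x : V) : R :=
  (mass G x)^-1 * \sum_(y \in [set y | adj G x y]) weight G x y * (f y - f x).

Definition Gamma (R : realType) (V : choiceType) (G : weighted_graph R V)
    (f g : V -> R) (x : V) : R :=
  2^-1 * (laplacian G (fun y => f y * g y) x
          - f x * laplacian G g x - g x * laplacian G f x).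

Definition Gamma2 (R : realType) (V : choiceType) (G : weighted_graph R V)
    (f : V -> R) (x : V) : R :=
  2^-1 * laplacian G (Gamma G f f) x - Gamma G f (laplacian G f) x.

(* The dimension D is meant to range over ]0, +oo]; since +oo^-1 = 0 for
   extended reals, the term in D vanishes for D = +oo. *)
Definition CD_at (R : realType) (V : choiceType) (G : weighted_graph R V)
    (K : R) (D : \bar R) (x : V) :=
  forall f : V -> R,
    fine (D^-1)%E * laplacian G f x ^+ 2 + K * Gamma G f f x <= Gamma2 G f x.

Definition CD (R : realType) (V : choiceType) (G : weighted_graph R V)
    (K : R) (D : \bar R) :=
  forall x, CD_at G K D x.

(* Main.v *)
(** Testing CD(0, oo) at a vertex x against a function that is harmonic at x
    and affine on each side of x gives, for the consecutive edge weights
    a, p, q, b around x, b/q + p/q + q/p + a/p <= 4, hence b/q <= 2 - a/p.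
    So along every second edge the ratios r_n = w_(n+1)/w_n satisfy
    r_(n+2) <= 2 - 1/r_n.  A positive sequence with x_(k+1) <= 2 - 1/x_k must
    start at a value >= 1, since otherwise it decreases at least linearly;
    run forwards on r and backwards on 1/r, this forces r = 1. *)
Require Import Defs.
From mathcomp Require Import all_boot all_order all_algebra.
From mathcomp Require Import all_classical all_reals ereal.
From mathcomp Require Import ring lra zify.

Import Order.TTheory GRing.Theory Num.Theory.
Local Open Scope ring_scope.

Lemma ge1_of_le_2subV (R : realType) (x : nat -> R) :
    (forall k, 0 < x k) -> (forall k, x k.+1 <= 2 - (x k)^-1) ->
  1 <= x 0%N.
Proof.
move=> x_gt0 x_rec; rewrite leNgt; apply/negP => x0_lt1.
set d := 1 - x 0%N.
have d2_gt0 : 0 < d ^+ 2 by rewrite exprn_gt0 // subr_gt0.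
(* Each step loses at least [(1 - x k) ^+ 2 / x k], and this is at least [d ^+ 2] because
   [x k <= x 0 < 1]. *)
have x_le k : x k <= x 0%N - k%:R * d ^+ 2.
  elim: k => [|k IHk]; first by lra.
  have kd_ge0 : 0 <= k%:R * d ^+ 2 by rewrite mulr_ge0 // ltW.
  have xk := x_gt0 k.
  have xVx : (x k)^-1 * x k = 1 by rewrite mulVf // gt_eqF.
  have xV_ge1 : 1 <= (x k)^-1 by rewrite invf_ge1 //; lra.
  have d_le : d ^+ 2 <= (1 - x k) ^+ 2.
    by rewrite lerXn2r ?nnegrE /d; lra.
  have -> : k.+1%:R = k%:R + 1 :> R by rewrite -natr1.
  have dV_le : 1 * d ^+ 2 <= (x k)^-1 * (1 - x k) ^+ 2.
    by apply: ler_pM => //; lra.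
  have stepE : (x k)^-1 * (1 - x k) ^+ 2 = (x k)^-1 - 2 + x k.
    by field; rewrite gt_eqF.
  by have := x_rec k; lra.
(* A [k] beyond [x 0 / d ^+ 2] makes the linear bound negative, against positivity. *)
have [_ lt_trunc] := andP (truncn_itv (ltW (divr_gt0 (x_gt0 0%N) d2_gt0))).
move: lt_trunc; set k := (Num.truncn _).+1.
rewrite ltr_pdivrMr // => lt_kd.
by have := x_le k; have := x_gt0 k; lra.
Qed.

Section LineGraph.
Variables (R : realType) (G : weighted_graph R int).
Hypotheses (G_linear : linear_on_Z G) (G_physical : physical G).

Let w (n : int) : R := weight G n (n + 1).

Lemma edge_weight_gt0 n : 0 < w n.
Proof. by apply: weight_gt0; apply/G_linear; left. Qed.

Lemma laplacian_line f n :
  laplacian G f n = w n * (f (n + 1) - f n) + w (n - 1) * (f (n - 1) - f n).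
Proof.
have nbhdE : [set y | adj G n y]%classic = ([set n + 1] `|` [set n - 1])%classic.
  apply/seteqP; split => y /= => [/G_linear|] => [] [->|->].
  - by left.
  - by right; rewrite addrK.
  - by apply/G_linear; left.
  - by apply/G_linear; right; rewrite subrK.
rewrite /laplacian G_physical invr1 mul1r nbhdE fsbigU0 //=; last first.
  by move=> y /= [-> /eqP]; lia.
by rewrite !fsbig_set1 /w subrK (weight_sym _ n (n - 1)).
Qed.

Lemma Gamma_line f g n :
  Gamma G f g n = 2^-1 * (w n * (f (n + 1) - f n) * (g (n + 1) - g n)
    + w (n - 1) * (f (n - 1) - f n) * (g (n - 1) - g n)).
Proof. by rewrite /Gamma !laplacian_line; ring. Qed.

Hypothesis G_CD : CD G 0 +oo%E.

Lemma ratio_le_of_CD (x : int) :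
  w (x + 1) / w x <= 2 - w (x - 1 - 1) / w (x - 1).
Proof.
(* The slopes are inverse to the weights of the two edges at [x], so the flow through both is 1 and
   the Laplacian of [f] vanishes at [x]. *)
pose f (y : int) : R :=
  if x <= y then (w x)^-1 * (y - x)%:~R else (w (x - 1))^-1 * (y - x)%:~R.
have f0 : f x = 0 by rewrite /f lexx subrr mulr0.
have f1 : f (x + 1) = (w x)^-1.
  by rewrite /f ifT; [rewrite addrC addKr mulr1 | lia].
have f2 : f (x + 1 + 1) = 2 * (w x)^-1.
  rewrite /f ifT; last lia.
  by have -> : x + 1 + 1 - x = 2 by [lia]; rewrite mulrC.
have fN1 : f (x - 1) = - (w (x - 1))^-1.
  rewrite /f ifF; last lia.
  by have -> : x - 1 - x = -1 by [lia]; rewrite mulrN1.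
have fN2 : f (x - 1 - 1) = - (2 * (w (x - 1))^-1).
  rewrite /f ifF; last lia.
  by have -> : x - 1 - 1 - x = -2 by [lia]; rewrite mulrN mulrC.
have := G_CD x f; rewrite invey /= !mul0r addr0 /Gamma2.
rewrite laplacian_line !Gamma_line !laplacian_line !addrK.
rewrite f0 f1 f2 fN1 fN2.
have := edge_weight_gt0 (x - 1); have := edge_weight_gt0 x.
move: (w (x - 1)) (w x) (w (x + 1)) (w (x - 1 - 1)) => p q b a q_gt0 p_gt0.
set G2 := (X in 0 <= X).
have q_neq0 : q != 0 by rewrite gt_eqF.
have p_neq0 : p != 0 by rewrite gt_eqF.
have -> : G2 = 4^-1 * (4 - b / q - p / q - a / p - q / p).
  by rewrite /G2; field; rewrite p_neq0 q_neq0.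
(* This is [p / q + q / p >= 2]; it removes the ratio of the two edges at [x] and leaves
   [b / q + a / p <= 2]. *)
have : 0 <= (p - q) ^+ 2 / (p * q).
  by rewrite divr_ge0 ?sqr_ge0 // mulr_ge0 // ltW.
have -> : (p - q) ^+ 2 / (p * q) = p / q + q / p - 2.
  by field; rewrite p_neq0 q_neq0.
lra.
Qed.

Lemma edge_weight_succ n : w (n + 1) = w n.
Proof.
pose r m := w (m + 1) / w m.
have r_gt0 m : 0 < r m by rewrite divr_gt0 ?edge_weight_gt0.
(* The index jumps by two because the ratio [r (m + 1)] of the two edges at the vertex [m + 2] has
   dropped out. *)
have r_rec m : r (m + 2) <= 2 - (r m)^-1.
  have := ratio_le_of_CD (m + 2); rewrite /r invf_div.
  have -> : m + 2 - 1 = m + 1 by lia.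
  by rewrite addrK.
have r_ge1 : 1 <= r n.
  have := @ge1_of_le_2subV R (fun k => r (n + (k * 2)%N%:Z)).
  rewrite mul0n addr0; apply=> k //.
  by have := r_rec (n + (k * 2)%N%:Z); congr (r _ <= _); lia.
(* Solved for [(r m)^-1], the recursion reads [(r m)^-1 <= 2 - r (m + 2)]: the reciprocals obey the
   same recursion leftwards. *)
have r_le1 : 1 <= (r n)^-1.
  have := @ge1_of_le_2subV R (fun k => (r (n - (k * 2)%N%:Z))^-1).
  rewrite mul0n subr0; apply=> k; first by rewrite invr_gt0.
  have := r_rec (n - (k.+1 * 2)%N%:Z); rewrite invrK.
  have -> : n - (k.+1 * 2)%N%:Z + 2 = n - (k * 2)%N%:Z by lia.
  by lra.
rewrite invf_ge1 // in r_le1.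
have r_eq1 : r n = 1 by apply/eqP; rewrite eq_le r_le1 r_ge1.
by rewrite -[RHS]mul1r -r_eq1 divfK // gt_eqF // edge_weight_gt0.
Qed.

End LineGraph.

Theorem theorem1p1 (R : realType) (G : weighted_graph R int)
    (G_linear : linear_on_Z G) (G_physical : physical G)
    (G_CD : CD G 0 +oo%E) :
  exists2 c : R, 0 < c & forall n : int, weight G n (n + 1) = c.
Proof.
exists (weight G 0 (0 + 1)); first exact: edge_weight_gt0.
have w_succ := edge_weight_succ _ _ G_linear G_physical G_CD.
elim/int_rec => [//|n IHn|n IHn]; rewrite -IHn.
  by rewrite -(w_succ n%:Z); congr weight; lia.
by rewrite -(w_succ (- n.+1%:Z)); congr weight; lia.
Qed.
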